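(* Let $\mathscr{H}$ be a complex Hilbert space and $T,S\in\mathbb{B}(\mathscr{H})$. Then the following statements are equivalent: (i) $T\perp_B S$. (ii) $\|T+\lambda S\|^2\ge\|T\|^2+|\lambda|^2\,m^2(S)$ for all $\lambda\in\mathbb{C}$.
   Context: Hilbert spaces are nonzero. $\mathbb{B}(\mathscr{H})$ is the algebra of bounded linear operators on $\mathscr{H}$ with the operator norm. The minimum modulus of $S$ is $m(S)=\inf\{\|S\xi\|:\xi\in\mathscr{H},\ \|\xi\|=1\}$, and $m^2(S)=(m(S))^2$. Birkhoff--James orthogonality: $T\perp_B S$ means $\|T+\lambda S\|\ge\|T\|$ for all $\lambda\in\mathbb{C}$. *)

(* Defs.v *)
From HB Require Import structures.
From mathcomp Require Import all_boot all_order all_algebra sesquilinear complex.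
From mathcomp Require Import all_classical all_reals all_analysis.

Set Implicit Arguments.
Unset Strict Implicit.
Unset Printing Implicit Defensive.

Import Order.TTheory GRing.Theory Num.Theory.
Import numFieldNormedType.Exports.

Local Open Scope classical_set_scope.
Local Open Scope ring_scope.
Local Open Scope complex_scope.

(* In a normed module over R[i] the norm takes its values in R[i] (they are
   nonnegative, hence real); [rnorm] is that norm read in R.  It also gives the
   modulus of a scalar. *)
Definition rnorm (R : realType) (V : normedZmodType R[i]) (x : V) : R :=
  complex.Re `|x|.

(* The norm of H is the one induced by the inner product [dot], which is linear
   in its first argument and conjugate-linear in the second. *)
Definition norm_from_dot (R : realType) (H : normedModType R[i])
    (dot : {dot H for Num.conj}) : Prop :=
  forall x : H, `|x| ^+ 2 = dot x x.

Definition bounded_operator (R : realType) (H : normedModType R[i])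
    (T : {linear H -> H}) : Prop :=
  exists M : R, forall x : H, rnorm (T x) <= M * rnorm x.

Definition opnorm (R : realType) (H : normedModType R[i]) (T : H -> H) : R :=
  sup [set rnorm (T x) | x in [set x : H | `|x| <= 1]].

Definition min_modulus (R : realType) (H : normedModType R[i])
    (S : H -> H) : R :=
  inf [set rnorm (S x) | x in [set x : H | `|x| = 1]].

Definition BJ_orthogonal (R : realType) (H : normedModType R[i])
    (T S : H -> H) : Prop :=
  forall lam : R[i], opnorm T <= opnorm (T \+ lam \*: S).

(* Main.v *)
Require Import Defs.
From mathcomp Require Import all_boot all_order all_algebra sesquilinear complex.
From mathcomp Require Import all_classical all_reals all_analysis.
From mathcomp Require Import ring lra.

Import numFieldNormedType.Exports.
Import Order.TTheory GRing.Theory Num.Theory.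

Local Open Scope ring_scope.
Local Open Scope complex_scope.

(** That the inequality implies orthogonality is clear: drop its nonnegative
    term and take square roots. For the converse, fix [lam]. In an inner product
    space, Stewart's identity
      |u + t w|^2 = (1 - t) |u|^2 + t |u + w|^2 - t (1 - t) |w|^2
    ([rnorm_stewart]) holds for every real [t]. Taking [u = T x] and
    [w = lam S x], with [0 <= t <= 1], and bounding the norms on the right by
    the operator norms and the minimum modulus gives
      ||T + t lam S||^2 <= (1 - t) ||T||^2 + t ||T + lam S||^2
                             - t (1 - t) |lam|^2 m(S)^2
    ([opnorm_convex]). By orthogonality the left-hand side is at least
    [||T||^2]; cancelling and dividing by [t > 0],
      ||T||^2 + (1 - t) |lam|^2 m(S)^2 <= ||T + lam S||^2,
    and letting [t] tend to 0 concludes. *)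

Section RealNorm.
Set Implicit Arguments.
Unset Strict Implicit.
Variable R : realType.

Lemma rnormE (V : normedZmodType R[i]) (x : V) : `|x| = (rnorm x)%:C.
Proof. by rewrite /rnorm RRe_real // ger0_real. Qed.

Lemma rnorm_ge0 (V : normedZmodType R[i]) (x : V) : 0 <= rnorm x.
Proof. by rewrite -lecR -rnormE normr_ge0. Qed.

Lemma rnorm0 (V : normedZmodType R[i]) : rnorm (0 : V) = 0.
Proof. by rewrite /rnorm normr0. Qed.

Lemma rnorm_gt0 (V : normedZmodType R[i]) (x : V) : x != 0 -> 0 < rnorm x.
Proof. by rewrite -ltcR -rnormE normr_gt0. Qed.

Variable H : normedModType R[i].

Lemma rnormD (x y : H) : rnorm (x + y) <= rnorm x + rnorm y.
Proof. by rewrite -lecR rmorphD /= -!rnormE ler_normD. Qed.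

Lemma rnormZ (a : R[i]) (x : H) : rnorm (a *: x) = rnorm a * rnorm x.
Proof. by apply: complexI; rewrite rmorphM /= -!rnormE normrZ. Qed.

Lemma rnorm_real (t : R) : 0 <= t -> rnorm (t%:C : R[i]) = t.
Proof. by move=> t0; apply: complexI; rewrite -rnormE ger0_norm ?lecR. Qed.

Lemma rnorm_normalize (x : H) :
  x != 0 -> `|((rnorm x)^-1)%:C *: x| = 1.
Proof.
move=> x0; have xp := rnorm_gt0 x0.
by rewrite rnormE rnormZ rnorm_real ?invr_ge0 ?rnorm_ge0 // mulVf ?gt_eqF.
Qed.

(** Stewart's theorem for the triangle with sides [u] and [u + w] and a cevian
    to the point [u + t w] of the third side. *)
Lemma rnorm_stewart (dot : {dot H for Num.conj}) (hdot : norm_from_dot dot)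
    (u w : H) (t : R) :
  rnorm (u + t%:C *: w) ^+ 2
  = (1 - t) * rnorm u ^+ 2 + t * rnorm (u + w) ^+ 2
    - t * (1 - t) * rnorm w ^+ 2.
Proof.
apply: complexI.
have conjt : Num.conj (t%:C : R[i]) = t%:C by rewrite conj_Creal ?complex_real.
rewrite !(rmorphXn, rmorphD, rmorphB, rmorphM, rmorphN, rmorph1) /= -!rnormE.
rewrite !hdot !(linearDl dot) !(linearDr dot) (linearZl_LR dot) (linearZr_LR dot).
rewrite (linearZl_LR dot) (linearZr_LR dot) /= conjt /GRing.scale /=; ring.
Qed.

End RealNorm.

Section OperatorNorm.
Set Implicit Arguments.
Unset Strict Implicit.
Variables (R : realType) (H : normedModType R[i]).

Lemma opnorm_le (f : H -> H) (c : R) :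
  0 <= c -> (forall x, rnorm (f x) <= c * rnorm x) -> opnorm f <= c.
Proof.
move=> c0 fc; apply: ge_sup.
  by exists (rnorm (f 0)); exists 0 => //=; rewrite normr0.
move=> _ [x /= x1 <-]; apply: le_trans (fc x) _.
by rewrite ler_piMr // -lecR -rnormE.
Qed.

Lemma bounded_operator_has_ubound (L : {linear H -> H}) :
  bounded_operator L ->
  has_ubound [set rnorm (L x) | x in [set x : H | `|x| <= 1]]%classic.
Proof.
move=> [M LM]; exists `|M| => _ [x /= x1 <-]; apply: le_trans (LM x) _.
have x1' : rnorm x <= 1 by rewrite -lecR -rnormE.
apply: le_trans (ler_wpM2r (rnorm_ge0 x) (ler_norm M)) _.
by rewrite ler_piMr.
Qed.

Lemma rnorm_le_opnorm (L : {linear H -> H}) (x : H) :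
  bounded_operator L -> rnorm (L x) <= opnorm L * rnorm x.
Proof.
move=> bL; have [->|x0] := eqVneq x 0; first by rewrite linear0 !rnorm0 mulr0.
have xp := rnorm_gt0 x0.
have : rnorm (L (((rnorm x)^-1)%:C *: x)) <= opnorm L.
  apply: (ub_le_sup (bounded_operator_has_ubound bL)).
  by eexists; last reflexivity; rewrite /= rnorm_normalize.
by rewrite linearZ rnormZ rnorm_real ?invr_ge0 ?rnorm_ge0 // mulrC ler_pdivrMr.
Qed.

Lemma opnorm_ge0 (L : {linear H -> H}) : bounded_operator L -> 0 <= opnorm L.
Proof.
move=> bL; apply: le_trans (rnorm_ge0 (L 0)) _.
apply: (ub_le_sup (bounded_operator_has_ubound bL)).
by exists 0 => //=; rewrite normr0.
Qed.

Lemma min_modulus_ge0 (f : H -> H) (x : H) : x != 0 -> 0 <= min_modulus f.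
Proof.
move=> x0; apply: lb_le_inf.
  by eexists; eexists; [exact: (rnorm_normalize x0)|reflexivity].
by move=> _ [y _ <-]; exact: rnorm_ge0.
Qed.

Lemma min_modulus_le_rnorm (L : {linear H -> H}) (x : H) :
  min_modulus L * rnorm x <= rnorm (L x).
Proof.
have [->|x0] := eqVneq x 0; first by rewrite linear0 !rnorm0 mulr0.
have xp := rnorm_gt0 x0.
have : min_modulus L <= rnorm (L (((rnorm x)^-1)%:C *: x)).
  apply: ge_inf.
    by exists 0 => _ [y _ <-]; exact: rnorm_ge0.
  by eexists; last reflexivity; rewrite /= rnorm_normalize.
by rewrite linearZ rnormZ rnorm_real ?invr_ge0 ?rnorm_ge0 // mulrC ler_pdivlMr.
Qed.

Lemma bounded_operatorD (T S : {linear H -> H}) (a : R[i]) :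
  bounded_operator T -> bounded_operator S ->
  bounded_operator (T \+ a \*: S : {linear H -> H}).
Proof.
move=> [M TM] [N SN]; exists (M + rnorm a * N) => x /=.
apply: le_trans (rnormD _ _) _; rewrite mulrDl rnormZ lerD // -mulrA.
by rewrite ler_wpM2l ?rnorm_ge0.
Qed.

(** Strong convexity of the squared norm along the segment from [T] to
    [T + a S], with modulus given by the minimum modulus of [a S]. *)
Lemma opnorm_convex (dot : {dot H for Num.conj}) (hdot : norm_from_dot dot)
    (Hnontrivial : exists x : H, x != 0) (T S : {linear H -> H})
    (hT : bounded_operator T) (hS : bounded_operator S) (a : R[i]) (t : R) :
  0 <= t <= 1 ->
  opnorm (T \+ (t%:C * a) \*: S) ^+ 2
  <= (1 - t) * opnorm T ^+ 2 + t * opnorm (T \+ a \*: S) ^+ 2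
     - t * (1 - t) * (rnorm a ^+ 2 * min_modulus S ^+ 2).
Proof.
move=> /andP[t0 t1]; set rhs := (X in _ <= X).
have [x0 x0N0] := Hnontrivial.
have hTS := bounded_operatorD a hT hS.
have pointwise x :
    rnorm ((T \+ (t%:C * a) \*: S) x) ^+ 2 <= rhs * rnorm x ^+ 2.
  rewrite /= -scalerA (rnorm_stewart hdot) rnormZ exprMn.
  have leT : rnorm (T x) ^+ 2 <= opnorm T ^+ 2 * rnorm x ^+ 2.
    rewrite -exprMn ler_sqr ?nnegrE ?mulr_ge0 ?rnorm_ge0 ?opnorm_ge0 //.
    exact: rnorm_le_opnorm.
  have leTS : rnorm (T x + a *: S x) ^+ 2
      <= opnorm (T \+ a \*: S) ^+ 2 * rnorm x ^+ 2.
    rewrite -exprMn ler_sqr ?nnegrE ?rnorm_ge0 //.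
      exact: (rnorm_le_opnorm x hTS).
    by rewrite mulr_ge0 ?rnorm_ge0 // (opnorm_ge0 hTS).
  have geS : min_modulus S ^+ 2 * rnorm x ^+ 2 <= rnorm (S x) ^+ 2.
    rewrite -exprMn ler_sqr ?nnegrE ?rnorm_ge0 ?min_modulus_le_rnorm //.
    by rewrite mulr_ge0 ?rnorm_ge0 // (min_modulus_ge0 _ x0N0).
  have s0 : 0 <= 1 - t by rewrite subr_ge0.
  have := lerD (ler_wpM2l s0 leT) (ler_wpM2l t0 leTS).
  have := ler_wpM2l (mulr_ge0 t0 s0) (ler_wpM2l (sqr_ge0 (rnorm a)) geS).
  rewrite /rhs; lra.
(* The bound at a nonzero vector forces [rhs] to be nonnegative, so that it
   has a square root. *)
have rhs0 : 0 <= rhs.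
  have xp : 0 < rnorm x0 ^+ 2 by rewrite exprn_gt0 // rnorm_gt0.
  by rewrite -(pmulr_lge0 _ xp); apply: le_trans (pointwise x0); rewrite sqr_ge0.
have hTt := bounded_operatorD (t%:C * a) hT hS.
rewrite -[rhs]sqr_sqrtr // ler_sqr ?nnegrE ?sqrtr_ge0 ?(opnorm_ge0 hTt) //.
apply: opnorm_le => [|x]; first exact: sqrtr_ge0.
rewrite -ler_sqr ?nnegrE ?mulr_ge0 ?rnorm_ge0 ?sqrtr_ge0 //.
by rewrite exprMn sqr_sqrtr.
Qed.

End OperatorNorm.

Theorem theorem2p9 (R : realType) (H : completeNormedModType R[i])
    (dot : {dot H for Num.conj}) (hdot : norm_from_dot dot)
    (Hnontrivial : exists x : H, x != 0)
    (T S : {linear H -> H})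
    (hT : bounded_operator T) (hS : bounded_operator S) :
  BJ_orthogonal T S <->
  (forall lam : R[i],
     opnorm T ^+ 2 + rnorm lam ^+ 2 * min_modulus S ^+ 2
       <= opnorm (T \+ lam \*: S) ^+ 2).
Proof.
split=> [orth lam|pyth lam]; last first.
  have hTS := bounded_operatorD lam hT hS.
  rewrite -ler_sqr ?nnegrE ?(opnorm_ge0 hT) ?(opnorm_ge0 hTS) //.
  apply: le_trans (pyth lam).
  by rewrite lerDl mulr_ge0 ?sqr_ge0.
set A := opnorm T ^+ 2; set C := opnorm _ ^+ 2; set B := rnorm lam ^+ 2 * _.
have B0 : 0 <= B by rewrite mulr_ge0 ?sqr_ge0.
have step t : 0 < t <= 1 -> A + (1 - t) * B <= C.
  move=> /andP[t0 t1].
  have t01 : 0 <= t <= 1 by rewrite ltW.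
  have := opnorm_convex hdot Hnontrivial hT hS lam t01.
  have hTt := bounded_operatorD (t%:C * lam) hT hS.
  have : A <= opnorm (T \+ (t%:C * lam) \*: S) ^+ 2.
    by rewrite ler_sqr ?nnegrE ?(opnorm_ge0 hT) ?(opnorm_ge0 hTt).
  move=> /le_trans h /h {h}; rewrite -/A -/B -/C => le_t.
  by rewrite -(ler_pM2l t0); lra.
apply/ler_addgt0Pr => e e0.
(* Any [t] in ]0, 1] with [t * B <= e] serves to let [t] tend to 0. *)
have d0 : 0 < B + e by rewrite ltr_wpDl.
have t01 : 0 < e / (B + e) <= 1.
  by rewrite divr_gt0 //= ler_pdivrMr // mul1r lerDr.
have tB : e / (B + e) * B <= e.
  by rewrite mulrAC -mulrA ler_piMr ?ltW // ltr_pdivrMr // mul1r ltrDl.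
have := step _ t01; lra.
Qed.
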